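(* Let $r:\mathbb{N}\to\mathbb{N}$ be a valid rate function, that is, $r$ is nondecreasing and $1\le r(n)\le n$ for all $n\in\mathbb{N}$. Then, for the set $\Omega=\{0,1\}^{\mathbb{N}}$, there is a probability measure $\mu$ on $\Omega^{\mathbb{N}}$ such that $$\limsup_{n\to\infty}\frac{R_\mu(n)}{r(n)}=1,$$ where $R_\mu$ is the $\eta$-mixing rate of the process $\mu$.
   Context: Here $\mathbb{N}=\{1,2,\ldots\}$. A random process is a probability measure $\mu$ on $\Omega^{\mathbb{N}}$; let $(X_1,X_2,\ldots)$ be a random sequence with law $\mu$, and let $\mu_n$ be the marginal distribution of $X_1^n=(X_1,\ldots,X_n)$. Write $X_j^n=(X_j,\ldots,X_n)$. For $1\le i<j\le n$ and $x\in\Omega^i$, let $\mathcal{L}(X_j^n\mid X_1^i=x)$ be the distribution of $X_j^n$ conditioned on $X_1^i=x$. For $y\in\Omega^{i-1}$ and $w,w'\in\Omega$ put $$\eta^{(n)}_{ij}(y,w,w')=\left\Vert \mathcal{L}(X_j^n\mid X_1^i=yw)-\mathcal{L}(X_j^n\mid X_1^i=yw')\right\Vert_{\mathrm{TV}},$$ where $yw\in\Omega^i$ denotes concatenation and $\Vert\nu\Vert_{\mathrm{TV}}=\frac12\Vert\nu\Vert_1$ is the total variation norm (half the total mass of $|\nu|$). The $\eta$-mixing coefficients of $\mu_n$ are $$\bar\eta^{(n)}_{ij}=\sup_{y\in\Omega^{i-1},\,w,w'\in\Omega}\eta^{(n)}_{ij}(y,w,w'),\qquad 1\le i<j\le n.$$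 Let $\Delta_n(\mu)$ be the upper-triangular $n\times n$ matrix with $(\Delta_n(\mu))_{ii}=1$ and $(\Delta_n(\mu))_{ij}=\bar\eta^{(n)}_{ij}$ for $1\le i<j\le n$. The $\eta$-mixing rate of $\mu$ is the function $R_\mu:\mathbb{N}\to\mathbb{R}$ given by the $\ell_\infty$ operator norm, which for a nonnegative matrix is the maximal row sum: $$R_\mu(n)=\Vert\Delta_n(\mu)\Vert_\infty=\max_{1\le i\le n}\Bigl(1+\sum_{j=i+1}^n\bar\eta^{(n)}_{ij}\Bigr).$$ *)

(* Defs.v *)
From HB Require Import structures.
From mathcomp Require Import all_boot all_order all_algebra.
From mathcomp Require Import all_classical all_reals all_analysis.
From mathcomp Require Import measurable_realfun.

Set Implicit Arguments.
Unset Strict Implicit.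
Unset Printing Implicit Defensive.
Import Order.TTheory GRing.Theory Num.Theory.
Local Open Scope classical_set_scope.
Local Open Scope ring_scope.
Local Open Scope ereal_scope.

(* The sequence space T^N with the product sigma-algebra. Coordinates are
   numbered from 0: the X_t of a sequence (X_1, X_2, ...) is x t.-1. *)
Definition seqspace (T : Type) : Type := nat -> T.

Definition seqspace_display : measure_display -> measure_display.
Proof. exact. Qed.

Definition cylinders d (T : measurableType d) : set (set (seqspace T)) :=
  \bigcup_t preimage_set_system setT (fun x : seqspace T => x t) measurable.

Section seqspace_measurable.
Context {d} {T : measurableType d}.

HB.instance Definition _ := Pointed.copy (seqspace T) (nat -> T).

Let seqspace_set0 : <<s @cylinders d T >> set0.
Proof. exact: sigma_algebra0. Qed.

Let seqspace_setC A : <<s @cylinders d T >> A -> <<s @cylinders d T >> (~` A).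
Proof. exact: sigma_algebraC. Qed.

Let seqspace_bigcup (F : (set (seqspace T))^nat) :
  (forall i, <<s @cylinders d T >> (F i)) ->
  <<s @cylinders d T >> (\bigcup_i F i).
Proof. exact: sigma_algebra_bigcup. Qed.

HB.instance Definition _ := @isMeasurable.Build (seqspace_display d)
  (seqspace T) <<s @cylinders d T >>
  seqspace_set0 seqspace_setC seqspace_bigcup.

End seqspace_measurable.

Section total_variation.
Context {d} {T : measurableType d} {R : realType}.

(* Half the total mass of |nu| = nu^+ + nu^-, which does not depend on the
   Hahn decomposition that is chosen. *)
Definition tv_norm (nu : {charge set T -> \bar R}) : \bar R :=
  (2^-1)%:E *
  charge_variation (svalP (cid (svalP (cid (Hahn_decomposition nu))))) setT.

Definition tv_dist (p q : probability T R) : \bar R :=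
  tv_norm (cadd (charge_of_finite_measure p)
                (copp (charge_of_finite_measure q))).

End total_variation.

(* k is a version of the conditional distribution L(Y | X = u) under P. *)
Definition conditional_law dS dU dV (S : measurableType dS)
    (U : measurableType dU) (V : measurableType dV) (R : realType)
    (P : probability S R) (X : S -> U) (Y : S -> V)
    (k : U -> probability V R) : Prop :=
  (forall B, measurable B -> measurable_fun [set: U] (k ^~ B)) /\
  (forall A B, measurable A -> measurable B ->
     P (X @^-1` A `&` Y @^-1` B) = \int[P]_(x in X @^-1` A) k (X x) B).

(* The entries of x with (0-based) indices a, ..., a + m - 1. *)
Definition block (T : Type) (a m : nat) (x : seqspace T) : m.-tuple T :=
  [tuple x (a + t)%N | t < m].

Section eta_mixing.
Context {d} {T : measurableType d} {R : realType}.
Variable mu : probability (seqspace T) R.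

(* The supremum over all y, w, w' for a given version k of the law of a block
   given X_1^(i+1); y w is rcons y w. *)
Definition eta_sup i m (k : i.+1.-tuple T -> probability (m.-tuple T) R) :
    \bar R :=
  ereal_sup [set e | exists (y : i.-tuple T) (w w' : T),
    e = tv_dist (k [tuple of rcons y w]) (k [tuple of rcons y w'])].

(* With 0-based i < j < n, the coefficient of the 1-based pair (i+1, j+1), i.e.
   the one for X_{j+1}^n given X_1^(i+1). A conditional law is determined by mu
   only up to a null set of conditioning values, so a supremum over all y, w, w'
   depends on the version; the infimum over all versions makes the coefficient
   depend on mu alone. For countable T this is the supremum over the y w, y w'
   that have positive probability. *)
Definition eta_bar (i j n : nat) : \bar R :=
  ereal_inf [set eta_sup k | k in
    conditional_law mu (@block T 0 i.+1) (@block T j (n - j))].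

Definition Delta (n : nat) : 'M[\bar R]_n :=
  \matrix_(i < n, j < n)
    if i == j then 1 else if (i < j)%N then eta_bar i j n else 0.

End eta_mixing.

(* The operator norm of a matrix on l_infty, as the maximal absolute row sum. *)
Definition linf_opnorm (R : realType) n (M : 'M[\bar R]_n) : \bar R :=
  \big[maxe/0]_(i < n) \sum_(j < n) `|M i j|.

Definition eta_mixing_rate d (T : measurableType d) (R : realType)
    (mu : probability (seqspace T) R) (n : nat) : \bar R :=
  linf_opnorm (Delta mu n).

(* The values at 0 are irrelevant: the domain is {1, 2, ...}. *)
Definition valid_rate (r : nat -> nat) : Prop :=
  (forall m n, (0 < m)%N -> (m <= n)%N -> (r m <= r n)%N) /\
  (forall n, (0 < n)%N -> (1 <= r n <= n)%N).

(* Main.v *)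
From HB Require Import structures.
Require Import Defs.
From mathcomp Require Import all_boot all_order all_algebra.
From mathcomp Require Import all_classical all_reals all_analysis.
From mathcomp Require Import measurable_realfun.
From mathcomp Require Import zify lra.

(** The process is built so that its mixing rate equals r(n) for every n >= 1;
    the limit superior is then the limit of an eventually constant sequence.

    Number times from 0 and put source m = m + 1 - r(m + 1), which is at most m.
    Let B_0, B_1, ... be independent bits that take both values with positive
    probability. A value X_t in {0,1}^N has a slot for every m, and slot m shows
    B_m at the two times source m and m and is 0 at all other times. Thus B_m is
    emitted at time source m and echoed at time m, and the window from emission
    to echo consists of exactly r(m + 1) times.

    Given X_0, ..., X_(i-1), the value X_i reveals the bits with source m = i,
    which are independent of all the others. So the law of X_j, ..., X_(n-1)
    depends on X_i if and only if there is an m with source m = i and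
    j <= m < n, and then two pasts with different B_m surely have different
    futures. Every coefficient is therefore 0 or 1 (lemmas [eta_bar_unlinked]
    and [eta_bar_linked]). If some m < n has source m = i, the ones in row i of
    Delta_n fill the columns from i to the largest such m, which makes
    r(m + 1) <= r(n) of them; otherwise there is only the one on the diagonal.
    The row of source (n - 1) has exactly r(n) ones
    ([eta_mixing_rate_process]). The sources of different m may coincide, even
    infinitely often (for r(n) = n they are all 0), which is why one value has to
    carry infinitely many bits.

    The independent bits are the binary digits of a geometric random variable:
    the weight of k is 2^-(k+1), and exchanging the digits of k and l in any set
    of positions preserves k + l, hence the weight of the pair (k, l). That
    invariance, [splice_series], is the only form of independence the argument
    uses. With this choice the process is a countable mixture of point masses,
    all of positive weight. Hence two versions of a conditional law agree on
    every past that occurs in one of these points, and the infimum over the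
    versions in the definition of the coefficients does no harm. *)

Set Implicit Arguments.
Unset Strict Implicit.
Unset Printing Implicit Defensive.
Import Order.TTheory GRing.Theory Num.Theory.
Local Open Scope classical_set_scope.
Local Open Scope ring_scope.
Local Open Scope ereal_scope.

(** * Binary digits *)

Definition bit (k m : nat) : bool := odd (iter m half k).
Definition numeral (M : nat) (b : nat -> bool) : nat :=
  (\sum_(m < M) b m * 2 ^ m)%N.

Lemma numeralS M b :
  numeral M.+1 b = (b 0%N + (numeral M (fun m => b m.+1)).*2)%N.
Proof.
rewrite /numeral big_ord_recl muln1; congr addn.
rewrite -muln2 big_distrl; apply: eq_bigr => m _ /=.
by rewrite /bump /= add1n expnSr mulnA.
Qed.

Lemma bitS k m : bit k m.+1 = bit k./2 m.
Proof. by rewrite /bit iterSr. Qed.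

Lemma bit_numeral M b m : bit (numeral M b) m = (m < M)%N && b m.
Proof.
elim: M b m => [|M IH] b m.
  by rewrite /numeral big_ord0 /bit; elim: m => // m; rewrite iterSr.
rewrite numeralS; case: m => [|m].
  by rewrite /bit/= oddD odd_double addbF; case: (b 0%N).
by rewrite bitS half_bit_double IH.
Qed.

Lemma numeral_bit M k : (k < 2 ^ M)%N -> numeral M (bit k) = k.
Proof.
elim: M k => [|M IH] k; first by rewrite expn0 /numeral big_ord0; lia.
rewrite expnS => kM; rewrite numeralS.
under [numeral _ _]eq_bigr do rewrite bitS.
by rewrite -/(numeral M (bit k./2)) IH ?odd_double_half//; lia.
Qed.

Lemma bit_inj k l : bit k =1 bit l -> k = l.
Proof.
move=> kl; have kE : numeral (k + l) (bit k) = k.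
  by rewrite numeral_bit// (leq_ltn_trans (leq_addr l k))// ltn_expl.
have lE : numeral (k + l) (bit l) = l.
  by rewrite numeral_bit// (leq_ltn_trans (leq_addl k l))// ltn_expl.
by rewrite -[LHS]kE -[RHS]lE; apply: eq_bigr => m _; rewrite kl.
Qed.

Lemma bit_small k m : (k <= m)%N -> bit k m = false.
Proof.
move=> km; have := bit_numeral k (bit k) m.
rewrite numeral_bit; last exact: ltn_expl.
by rewrite ltnNge km => ->.
Qed.

(** Both arguments have no digits at positions [k + l] and above, so truncating
    there loses nothing ([bit_splice]). *)
Definition splice (K : pred nat) (k l : nat) : nat :=
  numeral (k + l) (fun m => if K m then bit k m else bit l m).

Lemma bit_splice K k l m :
  bit (splice K k l) m = if K m then bit k m else bit l m.
Proof.
rewrite bit_numeral; case: ltnP => //= klm.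
by rewrite !bit_small ?if_same//; lia.
Qed.

(** Each digit of [k] and of [l] goes to exactly one of the two spliced numbers,
    at its own position. *)
Lemma splice_add K k l : (splice K k l + splice K l k = k + l)%N.
Proof.
have kE : numeral (k + l) (bit k) = k.
  by rewrite numeral_bit// (leq_ltn_trans (leq_addr l k))// ltn_expl.
have lE : numeral (k + l) (bit l) = l.
  by rewrite numeral_bit// (leq_ltn_trans (leq_addl k l))// ltn_expl.
rewrite -[X in (_ = X + _)%N]kE -[X in (_ = _ + X)%N]lE /splice (addnC l k).
rewrite -!big_split; apply: eq_bigr => m _ /=.
by case: ifP => // _; rewrite addnC.
Qed.

Lemma spliceK K k l : splice K (splice K k l) (splice K l k) = k.
Proof.
by apply: bit_inj => m; rewrite !bit_splice; case: (K m).
Qed.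

(** * Laws driven by a geometric random variable *)

Lemma nneseries_eq0 (R : realType) (u : nat -> \bar R) :
  (forall n, 0 <= u n) -> \sum_(n <oo) u n = 0 -> forall n, u n = 0.
Proof.
move=> u0 su n; apply/eqP; rewrite eq_le u0 andbT -su.
apply: (le_trans _ (nneseries_lim_ge n.+1 (fun k _ _ => u0 k))).
by rewrite big_nat_recr//= leeDr// sume_ge0.
Qed.

Section geometric_law.
Context {R : realType}.

Definition geometric_weight (n : nat) : R := (2^-1 ^+ n.+1)%R.

Lemma geometric_weight_gt0 n : (0 < geometric_weight n)%R.
Proof. by rewrite exprn_gt0// invr_gt0. Qed.

Let geometric_weight_ge0 n : (0 <= geometric_weight n)%R.
Proof. exact/ltW/geometric_weight_gt0. Qed.

Let w n : {nonneg R} := NngNum (geometric_weight_ge0 n).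

Lemma geometric_weight_sum : \sum_(n <oo) (geometric_weight n)%:E = 1.
Proof.
have := @cvg_geometric_eseries_half R 1 0; rewrite expr0 divr1 => h.
rewrite -(cvg_lim (@ereal_hausdorff R) h).
congr (limn _); apply/funext => n; apply: eq_bigr => k _.
by rewrite /geometric_weight addn1 div1r natrX exprVn.
Qed.

Section law.
Context d (T : measurableType d) (f : nat -> T).

Definition geometric_law : set T -> \bar R :=
  mseries (fun n => mscale (w n) \d_(f n)) 0.

HB.instance Definition _ := Measure.on geometric_law.

Lemma geometric_lawE A :
  geometric_law A = \sum_(n <oo) (geometric_weight n)%:E * \d_(f n) A.
Proof. by []. Qed.

Let geometric_law_setT : geometric_law setT = 1.
Proof.
rewrite geometric_lawE -geometric_weight_sum.
by apply: eq_eseriesr => n _; rewrite diracT mule1.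
Qed.

HB.instance Definition _ :=
  Measure_isProbability.Build _ _ R geometric_law geometric_law_setT.

Lemma integral_geometric_law (D : set T) (g : T -> \bar R) :
  measurable D -> measurable_fun D g -> (forall x, 0 <= g x) ->
  \int[geometric_law]_(x in D) g x =
    \sum_(n <oo) (geometric_weight n)%:E * (\d_(f n) D * g (f n)).
Proof.
move=> mD mg g0; rewrite ge0_integral_measure_series//.
by apply: eq_eseriesr => n _; rewrite ge0_integral_mscale// integral_dirac.
Qed.

End law.

(** Replacing the digits outside [K] by those of an independent copy does not
    change the law. The map sending (k, l) to (splice K k l, splice K l k) is an
    involution, and the weight of (k, l) depends on k + l only. *)
Lemma splice_series (K : pred nat) (F : nat -> R) : (forall n, 0 <= F n)%R ->
  \sum_(k <oo) (geometric_weight k)%:E *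
      \sum_(l <oo) (geometric_weight l)%:E * (F (splice K k l))%:E =
  \sum_(k <oo) (geometric_weight k)%:E * (F k)%:E.
Proof.
move=> F0.
have w0 k l : 0 <= (geometric_weight k)%:E * (geometric_weight l)%:E.
  by rewrite mule_ge0// lee_fin.
have pairE (G : nat -> nat -> \bar R) : (forall k l, 0 <= G k l) ->
    \sum_(k <oo) (geometric_weight k)%:E *
      \sum_(l <oo) (geometric_weight l)%:E * G k l =
    \esum_(p in [set: nat * nat])
      (geometric_weight p.1)%:E * (geometric_weight p.2)%:E * G p.1 p.2.
  move=> G0; rewrite -setXTT -(@esum_esum _ _ _ setT (fun=> setT)
    (fun k l => (geometric_weight k)%:E * (geometric_weight l)%:E * G k l));
    last by move=> k l _ _; rewrite mule_ge0.
  rewrite nneseries_esumT; last first.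
    move=> n; rewrite mule_ge0 ?lee_fin// nneseries_ge0// => l _ _.
    by rewrite mule_ge0 ?lee_fin.
  apply: eq_esum => k _.
  rewrite -nneseries_esumT; last by move=> l; rewrite mule_ge0.
  rewrite -nneseriesZl; last by move=> l _; rewrite mule_ge0 ?lee_fin.
  by apply: eq_eseriesr => l _; rewrite muleA.
rewrite (pairE (fun k l => (F (splice K k l))%:E)); last first.
  by move=> k l; rewrite lee_fin.
transitivity (\sum_(k <oo) (geometric_weight k)%:E *
    \sum_(l <oo) (geometric_weight l)%:E * (F k)%:E); last first.
  apply: eq_eseriesr => k _.
  congr (_ * _); under eq_eseriesr do rewrite muleC.
  rewrite nneseriesZl; last by move=> l _; rewrite lee_fin.
  by rewrite geometric_weight_sum mule1.
rewrite (pairE (fun k _ => (F k)%:E)); last by move=> k l; rewrite lee_fin.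
rewrite [RHS](reindex_esum setT setT
  (fun p => (splice K p.1 p.2, splice K p.2 p.1))).
  apply: eq_esum => -[k l] _ /=; congr (_ * _).
  rewrite -!EFinM /geometric_weight -!exprD; congr (_ ^+ _)%:E.
  by have := splice_add K k l; lia.
split=> //.
- move=> [k l] [k' l'] _ _ /= [e1 e2].
  have := spliceK K l k; have := spliceK K k l.
  by rewrite e1 e2 !spliceK => -> ->.
- move=> [k l] _; exists (splice K k l, splice K l k) => //=.
  by rewrite !spliceK.
Qed.

End geometric_law.
Arguments geometric_law R {d T} f.

(** * Total variation distance *)

Section total_variation.
Context {d} {T : measurableType d} {R : realType}.

Lemma charge_variation_setT (nu : {charge set T -> \bar R}) P N
    (h : hahn_decomposition nu P N) :
  charge_variation h setT = nu P - nu N.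
Proof.
have [[mP _] [mN _] _ _] := h.
rewrite /charge_variation !jordan_posE jordan_negE cjordan_posE cjordan_negE.
by rewrite /crestr0 !mem_set//= /crestr !setTI.
Qed.

Lemma charge_le_positive (nu : {charge set T -> \bar R}) P N
    (h : hahn_decomposition nu P N) B :
  measurable B -> nu B <= nu P.
Proof.
move=> mB; have [[mP posP] [mN negN] PNT PN0] := h.
rewrite (charge_partition nu mB mP mN PNT PN0).
rewrite (chargeDI nu mP mB) addeC (setIC P) leeD//; apply: (@le_trans _ _ 0).
  by apply: negN; [exact: measurableI|exact: subIsetr].
by apply: posP; [exact: measurableD|exact: subDsetl].
Qed.

(** When the total charge vanishes, the positive and negative parts have equal
    mass, so half the variation is the charge of the positive Hahn set. *)
Lemma tv_norm_max (nu : {charge set T -> \bar R}) : nu setT = 0 ->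
  exists2 P, measurable P &
    tv_norm nu = nu P /\ forall B, measurable B -> nu B <= nu P.
Proof.
move=> nuT; rewrite /tv_norm charge_variation_setT.
move: (svalP (cid (svalP (cid (Hahn_decomposition nu))))).
set P := sval (cid (Hahn_decomposition nu)); set N := sval _ => h.
have [[mP _] [mN _] PNT PN0] := h.
exists P => //; split; last by move=> B mB; exact: (charge_le_positive h mB).
have nuPN : nu P + nu N = 0 by rewrite -chargeU// PNT.
move: nuPN; rewrite -(fineK (fin_num_measure nu _ mP)) -(fineK (fin_num_measure nu _ mN)).
rewrite -EFinD => -[] nuPN; rewrite -EFinB -EFinM; congr EFin.
rewrite mulrBr; lra.
Qed.

Lemma tv_dist_max (p q : probability T R) : exists2 P, measurable P &
  tv_dist p q = p P - q P /\
  forall B, measurable B -> p B - q B <= p P - q P.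
Proof.
apply: tv_norm_max; transitivity (p setT - q setT) => //.
by rewrite !probability_setT subee.
Qed.

Lemma tv_dist_ge0 (p q : probability T R) : 0 <= tv_dist p q.
Proof.
have [P mP [-> /(_ _ (@measurable0 _ T))]] := tv_dist_max p q.
by rewrite !measure0 sube0.
Qed.

Lemma tv_dist_le1 (p q : probability T R) : tv_dist p q <= 1.
Proof.
have [P mP [-> _]] := tv_dist_max p q.
by rewrite leeBlDr ?fin_num_measure// (le_trans (probability_le1 _ mP))// leeDl.
Qed.

Lemma tv_dist_refl (p : probability T R) : tv_dist p p = 0.
Proof.
by have [P mP [-> _]] := tv_dist_max p p; rewrite subee// fin_num_measure.
Qed.

Lemma le_tv_dist (p q : probability T R) B : measurable B ->
  p B - q B <= tv_dist p q.
Proof. by have [P mP [-> +]] := tv_dist_max p q; apply. Qed.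

End total_variation.

(** * Measurability in sequence spaces *)

Section seqspace_measurability.
Context d (T : measurableType d).

Lemma measurable_coordinate t :
  measurable_fun [set: seqspace T] (fun x : seqspace T => x t).
Proof.
move=> _ Y mY; rewrite setTI; apply: sub_sigma_algebra.
by exists t => //; exists Y => //; rewrite setTI.
Qed.

Lemma measurable_fun_seqspace dU (U : measurableType dU) (f : U -> seqspace T) :
  (forall t, measurable_fun [set: U] (fun u => f u t)) ->
  measurable_fun [set: U] f.
Proof.
move=> mf; apply: (@measurability _ _ _ _ _ _ (@cylinders d T)) => //.
move=> _ [_ [t _ [Y mY <-]] <-].
by rewrite setTI; have := mf t measurableT _ mY.
Qed.

Lemma measurable_block a m : measurable_fun [set: seqspace T] (@block T a m).
Proof.
apply/measurable_fun_tnthP => t; rewrite (_ : _ \o _ = fun x => x (a + t)%N).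
  exact: measurable_coordinate.
by apply/funext => x /=; rewrite tnth_mktuple.
Qed.

End seqspace_measurability.

Lemma measurable_entry n (t : 'I_n) m :
  measurable_fun [set: n.-tuple (seqspace bool)]
    (fun u : n.-tuple (seqspace bool) => tnth u t m).
Proof.
exact: (measurableT_comp (measurable_coordinate (T := bool) m)
  (measurable_tnth (T := seqspace bool) t)).
Qed.

(** * The process and its mixing coefficients *)

Section process.
Context {R : realType} (src : nat -> nat).
Context (src_le : forall m, (src m <= m)%N).

Definition signal (b : nat -> bool) : seqspace (seqspace bool) :=
  fun t m => b m && ((t == src m) || (t == m)).

Definition process : probability (seqspace (seqspace bool)) R :=
  geometric_law R (fun k => signal (bit k)).

(** The bits that the past [u] shows are read off at the time of their emission,
    and the others are taken afresh from [l]. *)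
Definition resample i (u : i.+1.-tuple (seqspace bool)) (l m : nat) : bool :=
  if (src m <= i)%N then tnth u (inord (src m)) m else bit l m.

Definition block_kernel i j n (u : i.+1.-tuple (seqspace bool)) :
    probability ((n - j).-tuple (seqspace bool)) R :=
  geometric_law R (fun l => block j (n - j) (signal (resample u l))).

Lemma measurable_signal_resample i l :
  measurable_fun [set: i.+1.-tuple (seqspace bool)]
    (fun u => signal (resample u l)).
Proof.
apply: measurable_fun_seqspace => t; apply: measurable_fun_seqspace => m.
rewrite /signal /resample.
case: (_ || _); last first.
  by under eq_fun do rewrite andbF; exact: measurable_cst.
under eq_fun do rewrite andbT.
case: (src m <= i)%N; last exact: measurable_cst.
exact: measurable_entry.
Qed.

Lemma resample_block i k l :
  resample (block 0 i.+1 (signal (bit k))) l =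
  bit (splice (fun m => src m <= i)%N k l).
Proof.
apply/funext => m; rewrite bit_splice /resample; case: leqP => // mi.
by rewrite tnth_mktuple add0n inordK// /signal eqxx andbT.
Qed.

Lemma block_signal_splice i k l :
  block 0 i.+1 (signal (bit (splice (fun m => src m <= i)%N k l))) =
  block 0 i.+1 (signal (bit k)).
Proof.
apply: eq_from_tnth => t; rewrite !tnth_mktuple add0n; apply/funext => m.
rewrite /signal bit_splice; case: leqP => // im.
suff -> : (t == src m :> nat) || (t == m :> nat) = false by rewrite !andbF.
have := ltn_ord t; have := src_le m; lia.
Qed.

(** Independence of the digits, [splice_series], is what makes the resampled law
    a conditional law: if [u] is the past of [signal (bit k)], then resampling
    with [l] gives the signal of a spliced number, which has the same past and
    whose law over (k, l) is again geometric. *)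
Lemma block_kernel_conditional i j n :
  conditional_law process (@block _ 0 i.+1) (@block _ j (n - j))
    (@block_kernel i j n).
Proof.
have mK B : measurable B ->
    measurable_fun [set: i.+1.-tuple (seqspace bool)] (@block_kernel i j n ^~ B).
  move=> mB; apply: ge0_emeasurable_sum => [l u _ _|l _].
    by rewrite mule_ge0.
  apply: emeasurable_funM => //.
  rewrite (_ : (fun _ => _) = EFin \o (\1_B \o
    (fun u : i.+1.-tuple (seqspace bool) =>
      block j (n - j) (signal (resample u l))))) //.
  apply/measurable_EFinP; apply: measurableT_comp; first exact: measurable_indic.
  apply: measurableT_comp; first exact: measurable_block.
  exact: measurable_signal_resample.
split=> // A B mA mB.
have mXA : measurable (@block (seqspace bool) 0 i.+1 @^-1` A).
  by rewrite -[X in measurable X]setTI; exact: measurable_block.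
rewrite integral_geometric_law//; last first.
  apply: measurable_funTS.
  by apply: (measurableT_comp (mK _ mB)); exact: measurable_block.
pose F k : R := \1_(@block (seqspace bool) 0 i.+1 @^-1` A `&`
   @block (seqspace bool) j (n - j) @^-1` B) (signal (bit k)).
transitivity (\sum_(k <oo) (geometric_weight k)%:E * (F k)%:E) => //.
rewrite -(splice_series (fun m => src m <= i)%N); last by move=> k; rewrite /F.
apply: eq_eseriesr => k _; congr (_ * _).
rewrite /block_kernel /= geometric_lawE diracE -nneseriesZl; last first.
  by move=> l _; rewrite mule_ge0 ?lee_fin// ltW// geometric_weight_gt0.
apply: eq_eseriesr => l _; rewrite muleCA; congr (_ * _).
rewrite resample_block /F diracE -EFinM; congr EFin.
rewrite indicE in_setI -natrM mulnb; congr (_ && _)%:R.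
by apply/idP/idP; rewrite !inE /= block_signal_splice.
Qed.

Lemma eta_bar_ge0 i j n : 0 <= eta_bar process i j n.
Proof.
apply: le_ereal_inf_tmp => _ [k _ <-].
pose y : i.-tuple (seqspace bool) := [tuple of nseq i point].
apply: (le_trans (tv_dist_ge0 (k [tuple of rcons y point])
  (k [tuple of rcons y point]))).
by apply: ereal_sup_ubound; exists y, point, point.
Qed.

Lemma eta_bar_le_block_kernel i j n :
  eta_bar process i j n <= eta_sup (@block_kernel i j n).
Proof.
apply: ereal_inf_lbound; exists (@block_kernel i j n) => //.
exact: block_kernel_conditional.
Qed.

Lemma eta_bar_le1 i j n : eta_bar process i j n <= 1.
Proof.
apply: (le_trans (eta_bar_le_block_kernel _ _ _)).
by apply: ge_ereal_sup => _ [y [w [w' ->]]]; exact: tv_dist_le1.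
Qed.

(** [block_kernel] reads the last value of the past only in the slots [m] with
    [src m = i], and the future block has zeros in those slots. *)
Lemma eta_bar_unlinked i j n : (i < j)%N ->
  (forall m, (j <= m < n)%N -> src m != i) -> eta_bar process i j n = 0.
Proof.
move=> ij nlink; apply/eqP; rewrite eq_le eta_bar_ge0 andbT.
apply: (le_trans (eta_bar_le_block_kernel _ _ _)).
apply: ge_ereal_sup => _ [y [w [w' ->]]].
rewrite (_ : block_kernel j n [tuple of rcons y w] =
  block_kernel j n [tuple of rcons y w']) ?tv_dist_refl//.
congr geometric_law; apply/funext => l; apply: eq_from_tnth => t.
rewrite !tnth_mktuple; apply/funext => m; rewrite /signal.
have resampleE : src m != i ->
    resample [tuple of rcons y w] l m = resample [tuple of rcons y w'] l m.
  move=> mi; rewrite /resample; case: leqP => // mi'.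
  have {}mi : (src m < i)%N by lia.
  by rewrite !(tnth_nth point)/= !inordK// !nth_rcons size_tuple mi.
have [/resampleE -> //|/negPn/eqP mi] := boolP (src m != i).
have tn := ltn_ord t; rewrite mi.
have -> : (j + t == i)%N = false by lia.
case: (eqVneq (j + t)%N m) => [tm|_]; last by rewrite !andbF.
have jmn : (j <= m < n)%N by lia.
by have := nlink _ jmn; rewrite mi eqxx.
Qed.

(** Compare the pasts of the numbers 0 and 2^m. They differ only in slot [m] of
    the value at time [i], and both have positive probability. Since slot [m] is
    echoed at time [m], every version gives them mutually singular futures. *)
Lemma eta_bar_linked i j n m : (i < j)%N -> (j <= m < n)%N -> src m = i ->
  eta_bar process i j n = 1.
Proof.
move=> ij jmn mi; apply/eqP; rewrite eq_le eta_bar_le1 /=.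
apply: le_ereal_inf_tmp => _ [k [mk kE] <-].
have mjn : (m - j < n - j)%N by lia.
pose E (c : bool) : set (i.+1.-tuple (seqspace bool)) :=
  [set u | tnth u ord_max m = c].
pose D (c : bool) : set ((n - j).-tuple (seqspace bool)) :=
  [set v | tnth v (Ordinal mjn) m = c].
have mb (c : bool) : measurable [set c] by [].
have mE c : measurable (E c).
  by rewrite -[E c]setTI;
    exact: (measurable_entry ord_max m measurableT (mb c)).
have mD c : measurable (D c).
  by rewrite -[D c]setTI;
    exact: (measurable_entry (Ordinal mjn) m measurableT (mb c)).
pose X x := @block (seqspace bool) 0 i.+1 (signal (bit x)).
have EX x : (E (bit x m)) (X x).
  by rewrite /E/= tnth_mktuple add0n /signal mi eqxx andbT.
(* The bit shown in the past and the bit echoed in the block agree surely, and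
   all weights are positive, so the disagreement event is null for each [x]. *)
have kX x : k (X x) (D (~~ bit x m)) = 0.
  have mXE : measurable (@block (seqspace bool) 0 i.+1 @^-1` E (bit x m)).
    by rewrite -[Y in measurable Y]setTI; exact: measurable_block.
  have := kE (E (bit x m)) (D (~~ bit x m)) (mE _) (mD _).
  rewrite integral_geometric_law//; last first.
    apply: measurable_funTS.
    by apply: (measurableT_comp (mk _ (mD _))); exact: measurable_block.
  rewrite [LHS]geometric_lawE eseries0; last first.
    move=> y _ _; rewrite diracE memNset ?mule0// => -[/= Xy Yy].
    move: Xy Yy; rewrite /E /D/= !tnth_mktuple add0n subnKC; last by lia.
    by rewrite /signal mi !eqxx orbT !andbT => ->; case: (bit x m).
  move/esym/nneseries_eq0 => /(_ _ x)/eqP.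
  rewrite diracE mem_set ?mul1e; last exact: EX.
  rewrite mule_eq0 eqe gt_eqF ?geometric_weight_gt0//= => h; apply/eqP/h => y.
  by rewrite !mule_ge0// lee_fin ltW// geometric_weight_gt0.
pose y : i.-tuple (seqspace bool) := [tuple of nseq i (fun=> false)].
have XE x : (forall m', bit x m' -> m' = m) ->
    X x = [tuple of rcons y (signal (bit x) i)].
  move=> bx; apply: eq_from_tnth => t.
  rewrite tnth_mktuple add0n (tnth_nth point)/= nth_rcons size_nseq.
  case: ltnP => ti; last first.
    have -> : nat_of_ord t = i by have := ltn_ord t; lia.
    by rewrite eqxx.
  rewrite nth_nseq ti; apply/funext => m'; rewrite /signal.
  by case: (boolP (bit x m')) => // /bx ->; rewrite mi; apply/negbTE; lia.
pose x1 := numeral m.+1 (pred1 m).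
have bit_x1 m' : bit x1 m' = (m' == m).
  by rewrite bit_numeral /=; case: eqP => [->|]; rewrite ?ltnS ?leqnn ?andbF.
have bit_0 m' : bit 0 m' = false by rewrite bit_small.
have := kX 0%N; have := kX x1; rewrite bit_0 bit_x1 eqxx /=.
rewrite XE; last by move=> m'; rewrite bit_x1 => /eqP.
rewrite XE; last by move=> m'; rewrite bit_0.
set w1 := signal _ _; set w0 := signal _ _ => kw1 kw0.
apply: (@le_trans _ _
    (tv_dist (k [tuple of rcons y w1]) (k [tuple of rcons y w0]))).
  have := le_tv_dist (k [tuple of rcons y w1]) (k [tuple of rcons y w0])
    (mD true).
  rewrite kw0 sube0 (_ : D true = ~` D false); last first.
    by apply/seteqP; split=> v /=; rewrite /D /=; case: (tnth _ _ _).
  by rewrite probability_setC// kw1 sube0.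
by apply: ereal_sup_ubound; exists y, w1, w0.
Qed.

End process.

(** * The mixing rate *)

Section rate.
Context {R : realType} (r : nat -> nat) (hr : valid_rate r).

Definition source (m : nat) : nat := (m.+1 - r m.+1)%N.

Lemma source_le m : (source m <= m)%N.
Proof. by have := hr.2 m.+1 isT; rewrite /source; lia. Qed.

(** The window of bit [m] consists of r(m + 1) times, and [r] is monotone. *)
Lemma linked_lt i j n m : (j <= m < n)%N -> source m = i -> (j < i + r n)%N.
Proof.
have := hr.2 m.+1 isT; have := @hr.1 m.+1 n isT; rewrite /source; lia.
Qed.

Lemma Delta_process_le n (i j : 'I_n) :
  `|Delta (process source : probability _ R) n i j| <=
    ((i <= j < i + r n)%N%:R%:E : \bar R).
Proof.
have rn : (0 < r n)%N by have := hr.2 n; have := ltn_ord i; lia.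
rewrite mxE; have [->|ij] := eqVneq i j.
  by rewrite gee0_abs// leqnn/= -[X in (X < _)%N]addn0 ltn_add2l rn.
have [{}ij|ji] := ltnP i j; last by rewrite abse0 lee_fin.
rewrite gee0_abs; last exact: eta_bar_ge0.
rewrite (ltnW ij)/=.
case: ltnP => [_|jr]; first exact: (eta_bar_le1 source_le).
rewrite (eta_bar_unlinked source_le)//.
by move=> m /linked_lt h; apply/eqP => /h; rewrite ltnNge jr.
Qed.

(** The last bit echoed before time [n] is echoed at time [n.-1], hence within
    the block of every column of its row. *)
Lemma Delta_process_last n (i j : 'I_n) :
  i = source n.-1 :> nat -> (i <= j)%N ->
  Delta (process source : probability _ R) n i j = 1.
Proof.
move=> iE; rewrite mxE leq_eqVlt => /orP[ij|ij].
  by rewrite (_ : i == j).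
rewrite -(inj_eq val_inj)/= ltn_eqF// ij.
rewrite (eta_bar_linked source_le (m := n.-1))//.
by have := ltn_ord j; lia.
Qed.

Lemma sum_window n a s :
  (\sum_(j < n) (a <= j < a + s) = minn n (a + s) - minn n a)%N.
Proof.
elim: n => [|n IH]; first by rewrite big_ord0; lia.
by rewrite big_ord_recr/= IH; case: leqP; case: ltnP; lia.
Qed.

Lemma eta_mixing_rate_process n : (0 < n)%N ->
  eta_mixing_rate (process source : probability _ R) n = (r n)%:R%:E.
Proof.
move=> n0; have rn := hr.2 n n0.
have windowE i : \sum_(j < n) ((i <= j < i + r n)%N%:R%:E : \bar R) =
    (minn n (i + r n) - minn n i)%N%:R%:E.
  by rewrite sumEFin -natr_sum sum_window.
apply/eqP; rewrite eq_le; apply/andP; split.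
  apply: bigmax_le => [|i _]; first by rewrite lee_fin.
  apply: (@le_trans _ _ (\sum_(j < n) ((i <= j < i + r n)%N%:R%:E))).
    by apply: lee_sum => j _; exact: Delta_process_le.
  by rewrite windowE lee_fin ler_nat; lia.
have lt_source : (source n.-1 < n)%N by have := source_le n.-1; lia.
apply: (le_trans _ (le_bigmax _ _ (Ordinal lt_source))).
apply: (@le_trans _ _
    (\sum_(j < n) ((source n.-1 <= j < source n.-1 + r n)%N%:R%:E))).
  by rewrite windowE lee_fin ler_nat /source prednK//; lia.
apply: lee_sum => j _.
case: (leqP (source n.-1) j) => [sj|_]; last exact: abse_ge0.
by rewrite Delta_process_last// abse1 lee_fin; case: (_ < _)%N.
Qed.

End rate.

Theorem corollary2p9 (R : realType) (r : nat -> nat) (hr : valid_rate r) :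
  exists mu : probability (seqspace (seqspace bool)) R,
    limn_esup (fun n : nat => (eta_mixing_rate mu n * ((r n)%:R^-1)%:E)%E)
    = 1%E.
Proof.
exists (process (source r)).
suff /cvg_limn_einf_sup[_ ->] :
  (fun n => eta_mixing_rate (process (source r)) n * ((r n)%:R^-1)%:E) @ \oo
    --> (1 : \bar R) by [].
apply: cvg_near_cst; exists 1%N => // n /= n0.
rewrite eta_mixing_rate_process// -EFinM divff// pnatr_eq0.
by have := hr.2 n n0; lia.
Qed.
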